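(* The simplification phases $\Phi_{\mathtt{bridgeIn}}$ and $\Phi_{\mathtt{bridgeOut}}$ are complete. Explicitly, let $\Xi$ be a reduced context, $F=(F^+,F^-)$ a pair of sets of type and dirt parameters of $\Xi$, and $(\omega:\alpha\le\alpha')\in\Xi$ a type coercion parameter with $\alpha\neq\alpha'$. (In) Suppose $\omega$ is the only type coercion parameter of $\Xi$ whose right-hand side is $\alpha'$, and $\alpha'\notin F^-$. Let $\sigma=\{\alpha'\mapsto\alpha\}$. Then for every instantiation $\vdash\eta:\Xi\Rightarrow\Xi_{\mathrm{use}}$ there exist an instantiation $\vdash\eta':\sigma(\Xi)\Rightarrow\Xi_{\mathrm{use}}$ and a coercion family $Y$ with $\Xi_{\mathrm{use}}\vdash Y:(\eta'\circ\sigma)\le_F\eta$. (Out) Suppose $\omega$ is the only type coercion parameter of $\Xi$ whose left-hand side is $\alpha$, and $\alpha\notin F^+$. Let $\sigma=\{\alpha\mapsto\alpha'\}$. Then for every instantiation $\vdash\eta:\Xi\Rightarrow\Xi_{\mathrm{use}}$ there exist an instantiation $\vdash\eta':\sigma(\Xi)\Rightarrow\Xi_{\mathrm{use}}$ and a coercion family $Y$ with $\Xi_{\mathrm{use}}\vdash Y:(\eta'\circ\sigma)\le_F\eta$.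
   Context: SYNTAX. Fix a global signature $\Sigma$: a finite set of operations $op$. There are parameters of five kinds: skeleton $\varsigma$, dirt $\delta$, type $\alpha$, dirt coercion $\varpi$, type coercion $\omega$. Skeletons: $S::=\varsigma\mid\mathtt{Unit}\mid S_1\to S_2$. Dirts: $\Delta::=\delta\mid\emptyset\mid\{op\}\cup\Delta$, considered up to reordering and repetition of operations, so each dirt is $O$ or $O\cup\delta$ with $O$ a finite set of operations. Value types: $A::=\alpha\mid\mathtt{Unit}\mid A\to C$; computation types: $C::=A\,!\,\Delta$. A (parameter) context $\Xi$ is a finite list of distinct parameters: $\varsigma$; $\delta$; $\alpha:S$; $\varpi:\Delta_1\le\Delta_2$; $\omega:A_1\le A_2$. $\Xi\vdash S\ \mathtt{skel}$ (resp. $\Xi\vdash\Delta\ \mathtt{dirt}$) means all parameters of $S$ (resp. $\Delta$) are in $\Xi$ and all operations in $\Delta$ are in $\Sigma$. $\Xi\vdash A:S$ and $\Xi\vdash C:S$ (with $\Xi\vdash S\ \mathtt{skel}$) are given by: $\alpha:S$ if $(\alpha:S)\in\Xi$; $\mathtt{Unit}:\mathtt{Unit}$; $A\to C:S_1\to S_2$ if $A:S_1$, $C:S_2$; $A\,!\,\Delta:S$ if $A:S$ and $\Xi\vdash\Delta\ \mathtt{dirt}$. $\Xi$ is well-formed if all skeletons and dirts occurring in it are well-formed in $\Xi$ and for each $\omega:A_1\le A_2$ in $\Xi$ both $A_i$ have a common skeleton in $\Xi$. All contexts are assumed well-formed. A context is reduced if every type parameter in it is of the form $\alpha:\varsigma$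 with $\varsigma$ a skeleton parameter, every type coercion parameter is of the form $\omega:\alpha_1\le\alpha_2$ with $\alpha_1,\alpha_2$ type parameters, and every dirt coercion parameter is of the form $\varpi:\delta_1\le O$ or $\varpi:\delta_1\le O\cup\delta_2$. COERCIONS. Dirt coercions $\gamma_d::=\varpi\mid\gamma_d^2\circ\gamma_d^1\mid\langle\delta\rangle\mid\langle\emptyset\rangle\mid\emptyset_\delta\mid\{op\}\cup\gamma_d\mid\{op\}\cup^+\gamma_d$; value coercions $\gamma_v::=\omega\mid\gamma_v^2\circ\gamma_v^1\mid\langle\alpha\rangle\mid\langle\mathtt{Unit}\rangle\mid\gamma_v\to\gamma_c$; computation coercions $\gamma_c::=\gamma_v\,!\,\gamma_d$. Rules in context $\Xi$ (both sides are presupposed well-formed, and for types of the same skeleton): $\varpi,\omega$ have the inequality declared in $\Xi$; $\gamma^2\circ\gamma^1:X\le Z$ if $\gamma^1:X\le Y$, $\gamma^2:Y\le Z$; $\langle\delta\rangle:\delta\le\delta$; $\langle\emptyset\rangle:\emptyset\le\emptyset$; $\emptyset_\delta:\emptyset\le\delta$; if $\gamma_d:\Delta\le\Delta'$ then $\{op\}\cup\gamma_d:\{op\}\cup\Delta\le\{op\}\cup\Delta'$ and $\{op\}\cup^+\gamma_d:\Delta\le\{op\}\cup\Delta'$; $\langle\alpha\rangle:\alpha\le\alpha$; $\langle\mathtt{Unit}\rangle:\mathtt{Unit}\le\mathtt{Unit}$; $\gamma_v\to\gamma_c:(A\to C)\le(A'\to C')$ if $\gamma_v:A'\le A$, $\gamma_c:C\le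 C'$; $\gamma_v\,!\,\gamma_d:(A\,!\,\Delta)\le(A'\,!\,\Delta')$ if $\gamma_v:A\le A'$, $\gamma_d:\Delta\le\Delta'$. For arbitrary dirts and types define $\emptyset_\emptyset=\langle\emptyset\rangle$, $\emptyset_{\{op\}\cup\Delta}=\{op\}\cup^+\emptyset_\Delta$, $\langle\{op\}\cup\Delta\rangle=\{op\}\cup\langle\Delta\rangle$, $\langle A\to C\rangle=\langle A\rangle\to\langle C\rangle$, $\langle A\,!\,\Delta\rangle=\langle A\rangle\,!\,\langle\Delta\rangle$. SUBSTITUTIONS. A valid substitution $\vdash\sigma:\Xi\Rightarrow\Xi'$ assigns to every parameter of $\Xi$: to $\varsigma$ a skeleton with $\Xi'\vdash\sigma(\varsigma)\ \mathtt{skel}$; to $\delta$ a dirt with $\Xi'\vdash\sigma(\delta)\ \mathtt{dirt}$; to $\alpha:S$ a value type with $\Xi'\vdash\sigma(\alpha):\sigma(S)$; to $\varpi:\Delta_1\le\Delta_2$ a coercion $\Xi'\vdash\sigma(\varpi):\sigma(\Delta_1)\le\sigma(\Delta_2)$; to $\omega:A_1\le A_2$ a coercion $\Xi'\vdash\sigma(\omega):\sigma(A_1)\le\sigma(A_2)$. It acts homomorphically on skeletons, dirts, types, coercions (with $\sigma(\langle\delta\rangle)=\langle\sigma(\delta)\rangle$, $\sigma(\langle\alpha\rangle)=\langle\sigma(\alpha)\rangle$, $\sigma(\emptyset_\delta)=\emptyset_{\sigma(\delta)}$). Composition: $(\sigma'\circ\sigma)(p)=\sigma'(\sigma(p))$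 for each parameter $p$. Trivial mappings of parameters to themselves are omitted when writing $\sigma$. For $\sigma=\{\beta\mapsto\beta'\}$ with $\beta,\beta'$ type parameters of $\Xi$, $\sigma(\Xi)$ is $\Xi$ with $\beta$ removed and with $\beta$ replaced by $\beta'$ in all declared type inequalities (coercion parameters keep their names), so that $\vdash\sigma:\Xi\Rightarrow\sigma(\Xi)$. COERCION FAMILIES. A coercion family $Y$ assigns a value coercion $Y(\alpha)$ to each type parameter and a dirt coercion $Y(\delta)$ to each dirt parameter. For $\vdash\sigma_1,\sigma_2:\Xi\Rightarrow\Xi'$ and a pair $F=(F^+,F^-)$ of sets of type and dirt parameters, $\Xi'\vdash Y:\sigma_1\le_F\sigma_2$ means: for each type or dirt parameter $p\in F^+$, $\Xi'\vdash Y(p):\sigma_1(p)\le\sigma_2(p)$, and for each $p\in F^-$, $\Xi'\vdash Y(p):\sigma_2(p)\le\sigma_1(p)$. PHASES. A phase $\Phi$ takes a context $\Xi$ and a pair $F$ of sets of type and dirt parameters, and (on inputs to which it applies) returns $\Phi(\Xi,F)=(\Xi',\sigma)$ with $\vdash\sigma:\Xi\Rightarrow\Xi'$. Fix a context $\Xi_{\mathrm{use}}$; an instantiation of $\Xi$ is a valid substitution $\vdash\eta:\Xi\Rightarrow\Xi_{\mathrm{use}}$. $\Phi$ is complete if whenever $\Phi(\Xi,F)=(\Xi',\sigma)$, for every instantiation $\eta$ of $\Xi$ there are an instantiation $\eta'$ of $\Xi'$ and a coercion family $\Xi_{\mathrm{use}}\vdash Y:(\eta'\circ\sigma)\le_F\eta$.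 The phases of the claim return $(\sigma(\Xi),\sigma)$ under the stated conditions. *)

(* Defs.v *)
From Stdlib Require List.
From mathcomp Require Import all_boot.
From mathcomp Require Import finmap.

Set Implicit Arguments.
Unset Strict Implicit.
Unset Printing Implicit Defensive.

Local Open Scope fset_scope.

(* The five kinds of parameters have separate name spaces: a name is only ever
   used under the constructor of its kind. *)
Definition sparam := nat.   (* skeleton parameters *)
Definition dparam := nat.   (* dirt parameters *)
Definition tparam := nat.   (* type parameters *)
Definition dcparam := nat.  (* dirt coercion parameters *)
Definition tcparam := nat.  (* type coercion parameters *)

Inductive skel : Type :=
| SVar of sparam
| SUnit
| SArr of skel & skel.

Section Language.

(* [Op] is the universe of operation names and [Sig] the global signature. *)
Variables (Op : choiceType) (Sig : {fset Op}).

(* Dirts are taken up to reordering and repetition of operations, so a dirt is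
   a finite set of operations O, or O together with one dirt parameter. *)
Record dirt : Type := Dirt { dops : {fset Op}; dtail : option dparam }.

Definition dvar (d : dparam) : dirt := Dirt fset0 (Some d).
Definition dempty : dirt := Dirt fset0 None.
Definition dcons (op : Op) (D : dirt) : dirt := Dirt (op |` dops D) (dtail D).

Inductive vty : Type :=
| TVar of tparam
| TUnit
| TArr of vty & cty
with cty : Type :=
| CTy of vty & dirt.

Inductive dcoer : Type :=
| DCVar of dcparam
| DCComp of dcoer & dcoer    (* [DCComp g2 g1] is "g2 after g1" *)
| DCRefl of dparam
| DCReflEmpty
| DCEmpty of dparam
| DCOp of Op & dcoer         (* {op} added on both sides *)
| DCOpPlus of Op & dcoer.    (* {op} added on the right-hand side only *)

Inductive vcoer : Type :=
| VCVar of tcparam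
| VCComp of vcoer & vcoer    (* [VCComp g2 g1] is "g2 after g1" *)
| VCRefl of tparam
| VCReflUnit
| VCArr of vcoer & ccoer
with ccoer : Type :=
| CCo of vcoer & dcoer.

Inductive decl : Type :=
| DeclS of sparam
| DeclD of dparam
| DeclT of tparam & skel
| DeclDC of dcparam & dirt & dirt
| DeclTC of tcparam & vty & vty.

Definition ctx := seq decl.

Inductive param : Type :=
| PS of sparam | PD of dparam | PT of tparam | PDC of dcparam | PTC of tcparam.

Definition param_of (d : decl) : param :=
  match d with
  | DeclS s => PS s
  | DeclD d => PD d
  | DeclT a _ => PT a
  | DeclDC w _ _ => PDC w
  | DeclTC w _ _ => PTC w
  end.

Fixpoint wf_skel (X : ctx) (K : skel) : Prop :=
  match K with
  | SVar s => List.In (DeclS s) X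
  | SUnit => True
  | SArr K1 K2 => wf_skel X K1 /\ wf_skel X K2
  end.

Definition wf_dirt (X : ctx) (D : dirt) : Prop :=
  (dops D `<=` Sig) /\ (forall d, dtail D = Some d -> List.In (DeclD d) X).

Inductive has_vskel (X : ctx) : vty -> skel -> Prop :=
| HVar a K : List.In (DeclT a K) X -> wf_skel X K -> has_vskel X (TVar a) K
| HUnit : has_vskel X TUnit SUnit
| HArr A C K1 K2 : has_vskel X A K1 -> has_cskel X C K2 ->
    has_vskel X (TArr A C) (SArr K1 K2)
with has_cskel (X : ctx) : cty -> skel -> Prop :=
| HCTy A D K : has_vskel X A K -> wf_dirt X D -> has_cskel X (CTy A D) K.

Definition wf_decl (X : ctx) (d : decl) : Prop :=
  match d with
  | DeclS _ | DeclD _ => True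
  | DeclT _ K => wf_skel X K
  | DeclDC _ D1 D2 => wf_dirt X D1 /\ wf_dirt X D2
  | DeclTC _ A1 A2 => exists K, has_vskel X A1 K /\ has_vskel X A2 K
  end.

Definition wf_ctx (X : ctx) : Prop :=
  List.NoDup (List.map param_of X) /\ (forall d, List.In d X -> wf_decl X d).

Definition reduced_decl (d : decl) : Prop :=
  match d with
  | DeclS _ | DeclD _ => True
  | DeclT _ K => exists s, K = SVar s
  | DeclDC _ D1 D2 =>
      (exists d1, D1 = dvar d1) /\
      ((exists ops, D2 = Dirt ops None) \/ (exists ops d2, D2 = Dirt ops (Some d2)))
  | DeclTC _ A1 A2 => exists a1 a2, A1 = TVar a1 /\ A2 = TVar a2
  end.

Definition reduced (X : ctx) : Prop := forall d, List.In d X -> reduced_decl d.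

(* The presuppositions of the coercion judgements: both sides are well-formed,
   and have a common skeleton in the case of types. *)
Definition wf_dle (X : ctx) (D D' : dirt) : Prop := wf_dirt X D /\ wf_dirt X D'.
Definition wf_vle (X : ctx) (A A' : vty) : Prop :=
  exists K, has_vskel X A K /\ has_vskel X A' K.
Definition wf_cle (X : ctx) (C C' : cty) : Prop :=
  exists K, has_cskel X C K /\ has_cskel X C' K.

Inductive dco (X : ctx) : dcoer -> dirt -> dirt -> Prop :=
| dco_var w D D' : List.In (DeclDC w D D') X -> wf_dle X D D' ->
    dco X (DCVar w) D D'
| dco_comp g2 g1 D1 D2 D3 : dco X g1 D1 D2 -> dco X g2 D2 D3 ->
    wf_dle X D1 D3 -> dco X (DCComp g2 g1) D1 D3
| dco_refl d : wf_dle X (dvar d) (dvar d) -> dco X (DCRefl d) (dvar d) (dvar d)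
| dco_refl_empty : wf_dle X dempty dempty -> dco X DCReflEmpty dempty dempty
| dco_empty d : wf_dle X dempty (dvar d) -> dco X (DCEmpty d) dempty (dvar d)
| dco_op op g D D' : dco X g D D' -> wf_dle X (dcons op D) (dcons op D') ->
    dco X (DCOp op g) (dcons op D) (dcons op D')
| dco_op_plus op g D D' : dco X g D D' -> wf_dle X D (dcons op D') ->
    dco X (DCOpPlus op g) D (dcons op D').

Inductive vco (X : ctx) : vcoer -> vty -> vty -> Prop :=
| vco_var w A A' : List.In (DeclTC w A A') X -> wf_vle X A A' ->
    vco X (VCVar w) A A'
| vco_comp g2 g1 A1 A2 A3 : vco X g1 A1 A2 -> vco X g2 A2 A3 ->
    wf_vle X A1 A3 -> vco X (VCComp g2 g1) A1 A3
| vco_refl a : wf_vle X (TVar a) (TVar a) ->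
    vco X (VCRefl a) (TVar a) (TVar a)
| vco_refl_unit : wf_vle X TUnit TUnit -> vco X VCReflUnit TUnit TUnit
| vco_arr gv gc A A' C C' : vco X gv A' A -> cco X gc C C' ->
    wf_vle X (TArr A C) (TArr A' C') ->
    vco X (VCArr gv gc) (TArr A C) (TArr A' C')
with cco (X : ctx) : ccoer -> cty -> cty -> Prop :=
| cco_bang gv gd A A' D D' : vco X gv A A' -> dco X gd D D' ->
    wf_cle X (CTy A D) (CTy A' D') ->
    cco X (CCo gv gd) (CTy A D) (CTy A' D').

(* The order in which the operations of a dirt are added is immaterial; we use
   the enumeration of the finite set. *)
Definition dempty_to (D : dirt) : dcoer :=
  foldr DCOpPlus (if dtail D is Some d then DCEmpty d else DCReflEmpty)
    (enum_fset (dops D)).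

Definition did (D : dirt) : dcoer :=
  foldr DCOp (if dtail D is Some d then DCRefl d else DCReflEmpty)
    (enum_fset (dops D)).

Fixpoint vid (A : vty) : vcoer :=
  match A with
  | TVar a => VCRefl a
  | TUnit => VCReflUnit
  | TArr A C => VCArr (vid A) (cid C)
  end
with cid (C : cty) : ccoer :=
  match C with CTy A D => CCo (vid A) (did D) end.

(* Substitutions are total on names; their validity only concerns the
   parameters of the source context. *)
Record subst : Type := Subst {
  sub_s : sparam -> skel;
  sub_d : dparam -> dirt;
  sub_t : tparam -> vty;
  sub_dc : dcparam -> dcoer;
  sub_tc : tcparam -> vcoer }.

Fixpoint app_skel (s : subst) (K : skel) : skel :=
  match K with
  | SVar x => sub_s s x
  | SUnit => SUnit
  | SArr K1 K2 => SArr (app_skel s K1) (app_skel s K2)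
  end.

Definition app_dirt (s : subst) (D : dirt) : dirt :=
  if dtail D is Some d
  then Dirt (dops D `|` dops (sub_d s d)) (dtail (sub_d s d))
  else D.

Fixpoint app_vty (s : subst) (A : vty) : vty :=
  match A with
  | TVar a => sub_t s a
  | TUnit => TUnit
  | TArr A C => TArr (app_vty s A) (app_cty s C)
  end
with app_cty (s : subst) (C : cty) : cty :=
  match C with CTy A D => CTy (app_vty s A) (app_dirt s D) end.

Fixpoint app_dcoer (s : subst) (g : dcoer) : dcoer :=
  match g with
  | DCVar w => sub_dc s w
  | DCComp g2 g1 => DCComp (app_dcoer s g2) (app_dcoer s g1)
  | DCRefl d => did (sub_d s d)
  | DCReflEmpty => DCReflEmpty
  | DCEmpty d => dempty_to (sub_d s d)
  | DCOp op g => DCOp op (app_dcoer s g)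
  | DCOpPlus op g => DCOpPlus op (app_dcoer s g)
  end.

Fixpoint app_vcoer (s : subst) (g : vcoer) : vcoer :=
  match g with
  | VCVar w => sub_tc s w
  | VCComp g2 g1 => VCComp (app_vcoer s g2) (app_vcoer s g1)
  | VCRefl a => vid (sub_t s a)
  | VCReflUnit => VCReflUnit
  | VCArr gv gc => VCArr (app_vcoer s gv) (app_ccoer s gc)
  end
with app_ccoer (s : subst) (g : ccoer) : ccoer :=
  match g with CCo gv gd => CCo (app_vcoer s gv) (app_dcoer s gd) end.

Definition valid_subst (X : ctx) (s : subst) (X' : ctx) : Prop :=
  forall d, List.In d X ->
  match d with
  | DeclS x => wf_skel X' (sub_s s x)
  | DeclD x => wf_dirt X' (sub_d s x)
  | DeclT a K => has_vskel X' (sub_t s a) (app_skel s K)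
  | DeclDC w D1 D2 => dco X' (sub_dc s w) (app_dirt s D1) (app_dirt s D2)
  | DeclTC w A1 A2 => vco X' (sub_tc s w) (app_vty s A1) (app_vty s A2)
  end.

(* [comp_subst s' s] is "s' after s". *)
Definition comp_subst (s' s : subst) : subst :=
  Subst (fun x => app_skel s' (sub_s s x))
        (fun x => app_dirt s' (sub_d s x))
        (fun x => app_vty s' (sub_t s x))
        (fun x => app_dcoer s' (sub_dc s x))
        (fun x => app_vcoer s' (sub_tc s x)).

(* The substitution {b |-> b'}, for type parameters b and b'. *)
Definition ren (b b' : tparam) : subst :=
  Subst SVar dvar (fun a => if a == b then TVar b' else TVar a) DCVar VCVar.

Definition ren_decl (b b' : tparam) (d : decl) : option decl :=
  match d with
  | DeclT a _ => if a == b then None else Some d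
  | DeclTC w A1 A2 =>
      Some (DeclTC w (app_vty (ren b b') A1) (app_vty (ren b b') A2))
  | _ => Some d
  end.

Definition ren_ctx (b b' : tparam) (X : ctx) : ctx := pmap (ren_decl b b') X.

(* A set of type and dirt parameters. *)
Record pset : Type := PSet { pset_t : {fset tparam}; pset_d : {fset dparam} }.

(* A pair F = (F^+, F^-). *)
Definition polarity : Type := (pset * pset)%type.

Definition pset_in (X : ctx) (P : pset) : Prop :=
  (forall a, a \in pset_t P -> exists K, List.In (DeclT a K) X) /\
  (forall d, d \in pset_d P -> List.In (DeclD d) X).

Definition polarity_in (X : ctx) (F : polarity) : Prop :=
  pset_in X F.1 /\ pset_in X F.2.

Record family : Type := Family { fam_t : tparam -> vcoer; fam_d : dparam -> dcoer }.

Definition fam_le (X' : ctx) (Y : family) (s1 s2 : subst) (F : polarity) : Prop :=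
  [/\ forall a, a \in pset_t F.1 -> vco X' (fam_t Y a) (sub_t s1 a) (sub_t s2 a),
      forall d, d \in pset_d F.1 -> dco X' (fam_d Y d) (sub_d s1 d) (sub_d s2 d),
      forall a, a \in pset_t F.2 -> vco X' (fam_t Y a) (sub_t s2 a) (sub_t s1 a)
    & forall d, d \in pset_d F.2 -> dco X' (fam_d Y d) (sub_d s2 d) (sub_d s1 d)].

(* A phase is given by its graph, [returns X F X' s] meaning that it may return
   (X', s) on (X, F): it need not apply to every input, and it may have a choice
   of the coercion parameter to eliminate. *)
Record phase : Type := Phase {
  returns : ctx -> polarity -> ctx -> subst -> Prop;
  returns_valid : forall X F X' s, returns X F X' s ->
    wf_ctx X' /\ valid_subst X s X' }.

Definition complete (Xuse : ctx) (P : phase) : Prop :=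
  forall X F X' s, returns P X F X' s ->
  forall eta, valid_subst X eta Xuse ->
  exists eta' Y, valid_subst X' eta' Xuse /\
    fam_le Xuse Y (comp_subst eta' s) eta F.

Definition bridge_in_returns (X : ctx) (F : polarity) (X' : ctx) (s : subst) : Prop :=
  [/\ wf_ctx X, reduced X, polarity_in X F &
   exists w a a', [/\ List.In (DeclTC w (TVar a) (TVar a')) X, a <> a',
      forall w' A, List.In (DeclTC w' A (TVar a')) X -> w' = w,
      a' \notin pset_t F.2 &
      X' = ren_ctx a' a X /\ s = ren a' a]].

Definition bridge_out_returns (X : ctx) (F : polarity) (X' : ctx) (s : subst) : Prop :=
  [/\ wf_ctx X, reduced X, polarity_in X F &
   exists w a a', [/\ List.In (DeclTC w (TVar a) (TVar a')) X, a <> a',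
      forall w' A, List.In (DeclTC w' (TVar a) A) X -> w' = w,
      a \notin pset_t F.1 &
      X' = ren_ctx a a' X /\ s = ren a a']].

(* The rest of this file shows that {b |-> b'} is a valid substitution into a
   well-formed context, as required of a phase, whenever b and b' are distinct
   type parameters of the same skeleton. *)

Lemma In_pmap (T U : Type) (f : T -> option U) (s : seq T) y :
  List.In y (pmap f s) <-> exists2 x, List.In x s & f x = Some y.
Proof.
elim: s => [|x s IH] /=; first by split=> // -[].
case E: (f x) => [z|] /=; split.
- case=> [<-|/IH [t ts ft]]; [by exists x => //; left | by exists t => //; right].
- case=> t [<-|ts] ft; [by left; move: ft; rewrite E => -[] | right; apply/IH; by exists t].
- by case/IH=> t ts ft; exists t => //; right.
- by case=> t [<-|ts] ft; [rewrite E in ft | apply/IH; exists t].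
Qed.

Lemma param_of_inj X d d' : wf_ctx X -> List.In d X -> List.In d' X ->
  param_of d = param_of d' -> d = d'.
Proof.
case=> + _; elim: X => //= e X IH H; inversion_clear H as [|? ? Hn Hd].
case=> [<-|dX] [<-|dX'] E //; last exact: IH.
- by case: Hn; rewrite E; apply: List.in_map.
- by case: Hn; rewrite -E; apply: List.in_map.
Qed.

Section Rename.

Variables (b b' : tparam) (X : ctx).

Lemma param_ren d d' : ren_decl b b' d = Some d' -> param_of d' = param_of d.
Proof. by case: d => [s|s|a K|w D D'|w A A'] /=; try case: ifP => // _; case=> <-. Qed.

Lemma ren_skel K : app_skel (ren b b') K = K.
Proof. by elim: K => //= K1 -> K2 ->. Qed.

Lemma ren_dirt D : app_dirt (ren b b') D = D.
Proof. by case: D => ops [d|] //; rewrite /app_dirt /= fsetU0. Qed.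

Lemma in_ren_S s : List.In (DeclS s) X -> List.In (DeclS s) (ren_ctx b b' X).
Proof. by move=> H; apply/In_pmap; exists (DeclS s). Qed.

Lemma in_ren_D d : List.In (DeclD d) X -> List.In (DeclD d) (ren_ctx b b' X).
Proof. by move=> H; apply/In_pmap; exists (DeclD d). Qed.

Lemma wf_skel_ren K : wf_skel X K -> wf_skel (ren_ctx b b' X) K.
Proof.
by elim: K => [s||K1 IH1 K2 IH2] //=; [apply: in_ren_S | case=> /IH1 ? /IH2 ?].
Qed.

Lemma wf_dirt_ren D : wf_dirt X D -> wf_dirt (ren_ctx b b' X) D.
Proof. by case=> H1 H2; split=> // d /H2 /in_ren_D. Qed.

Hypotheses (wfX : wf_ctx X) (redX : reduced X) (neq_b : b <> b').
Variable (K0 : skel).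
Hypotheses (bX : List.In (DeclT b K0) X) (b'X : List.In (DeclT b' K0) X).

Lemma tvar_ren a K : List.In (DeclT a K) X ->
  has_vskel (ren_ctx b b' X) (sub_t (ren b b') a) K.
Proof.
move=> aX; have wfS := wf_skel_ren (proj2 wfX _ aX).
have keep c : c <> b -> List.In (DeclT c K) X ->
    has_vskel (ren_ctx b b' X) (TVar c) K.
  move=> /eqP/negbTE nc cX; apply: HVar => //.
  by apply/In_pmap; exists (DeclT c K) => //=; rewrite nc.
rewrite /=; case: (eqVneq a b) => [ab|/eqP nab]; last exact: keep.
subst a; have [eS] : DeclT b K = DeclT b K0 by exact: (param_of_inj wfX).
by subst K; apply: keep => // /esym.
Qed.

Lemma vle_ren w A A' : List.In (DeclTC w A A') X ->
  wf_vle (ren_ctx b b' X) (app_vty (ren b b') A) (app_vty (ren b b') A').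
Proof.
move=> wX; have [a [a' [eA eA']]] := redX wX.
have [K [HA HA']] := proj2 wfX _ wX; subst A A'; exists K.
by inversion_clear HA; inversion_clear HA'; split; apply: tvar_ren.
Qed.

Lemma ren_ctx_wf : wf_ctx (ren_ctx b b' X).
Proof.
split.
  case: wfX => + _; rewrite /ren_ctx; elim: (X) => //= d Y IH H.
  inversion_clear H as [|? ? Hn Hd].
  case E: (ren_decl b b' d) => [e|] /=; last exact: IH.
  constructor; last exact: IH.
  move=> /List.in_map_iff [f [pf /In_pmap [g gY fg]]]; apply: Hn.
  by rewrite -(param_ren E) -pf (param_ren fg); apply: List.in_map.
move=> d' /In_pmap [d dX]; have := proj2 wfX _ dX; move: dX.
case: d => [s|s|a K|w D D'|w A A'] /= dX wfd.
- by case=> <-.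
- by case=> <-.
- by case: ifP => // _ [<-]; apply: wf_skel_ren.
- by case=> <-; case: wfd; split; apply: wf_dirt_ren.
- by case=> <-; apply: vle_ren dX.
Qed.

Lemma ren_valid : valid_subst X (ren b b') (ren_ctx b b' X).
Proof.
case=> [s|s|a K|w D D'|w A A'] dX.
- exact: in_ren_S.
- by split=> [|e [<-]]; [exact: fsub0set | exact: in_ren_D].
- by rewrite ren_skel; apply: tvar_ren.
- rewrite !ren_dirt; apply: dco_var.
    by apply/In_pmap; exists (DeclDC w D D').
  by have [wfD wfD'] := proj2 wfX _ dX; split; apply: wf_dirt_ren.
- apply: vco_var; last exact: vle_ren dX.
  by apply/In_pmap; exists (DeclTC w A A').
Qed.

End Rename.

Lemma bridge_in_valid X F X' s : bridge_in_returns X F X' s ->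
  wf_ctx X' /\ valid_subst X s X'.
Proof.
case=> wfX redX _ [w [a [a' [wX neq_a _ _ [-> ->]]]]].
have [K [Ha Ha']] := proj2 wfX _ wX.
inversion Ha; inversion Ha'; subst.
by split; [apply: ren_ctx_wf | apply: ren_valid]; eauto.
Qed.

Lemma bridge_out_valid X F X' s : bridge_out_returns X F X' s ->
  wf_ctx X' /\ valid_subst X s X'.
Proof.
case=> wfX redX _ [w [a [a' [wX neq_a _ _ [-> ->]]]]].
have [K [Ha Ha']] := proj2 wfX _ wX.
inversion Ha; inversion Ha'; subst.
by split; [apply: ren_ctx_wf | apply: ren_valid]; eauto.
Qed.

Definition bridge_in : phase := Phase bridge_in_valid.
Definition bridge_out : phase := Phase bridge_out_valid.

End Language.

(* Main.v *)
(** Let [sigma = {b |-> b'}], and let [eta] be the given instantiation. The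
    instantiation [eta'] agrees with [eta] except on type coercion parameters,
    so that [eta' (sigma p) = eta p] for every [p <> b], and the family [Y] is
    the identity there; at [b] it is [eta w], which has the direction required by
    [F^+] for (In) and by [F^-] for (Out). A coercion parameter having [b] on
    the side opposite to [w] is instantiated by composing its image under [eta]
    with [eta w]. By uniqueness of [w], the only one having [b] on the same side
    as [w] is [w] itself, which becomes reflexive and is instantiated by an
    identity. *)

Require Import Defs.
From mathcomp Require Import all_boot finmap.

Set Implicit Arguments.
Unset Strict Implicit.
Unset Printing Implicit Defensive.

Local Open Scope fset_scope.

Scheme vty_mutind := Induction for vty Sort Prop
with cty_mutind := Induction for cty Sort Prop.

Section Coercions.

Variables (Op : choiceType) (Sig : {fset Op}) (X : ctx Op).

(** Links the list recursion of [did] to dirts as sets of operations. *)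
Lemma foldr_dcons (s : seq Op) (t : option dparam) :
  foldr (@dcons Op) (Dirt fset0 t) s = Dirt [fset x in s] t.
Proof.
elim: s => [|op s /= ->]; first by congr Dirt; apply/fsetP => x; rewrite !inE.
by rewrite /dcons /=; congr Dirt; apply/fsetP => x; rewrite !inE.
Qed.

Lemma did_dco D : wf_dirt Sig X D -> dco Sig X (did D) D D.
Proof.
case: D => ops t wfD; have [/= opsS tX] := wfD.
(* [did] recurses on an enumeration, so both sides are written as an iterated [dcons] over it; the
   enumeration is then generalised to any list of operations of [Sig]. *)
have eD (O : {fset Op}) : foldr (@dcons Op) (Dirt fset0 t) (enum_fset O) = Dirt O t.
  by rewrite foldr_dcons; congr Dirt; apply/fsetP => x; rewrite !inE.
rewrite /did -[X in dco _ _ _ X _]eD -[X in dco _ _ _ _ X]eD /=.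
have {}opsS : {subset enum_fset ops <= Sig} by move=> x; apply: (fsubsetP opsS).
elim: (enum_fset ops) opsS => [|op s IH] sS /=.
  have wf0 : wf_dirt Sig X (Dirt fset0 t) by split=> //=; apply: fsub0set.
  by case: (t) wf0 => [d|] wf0; [apply: dco_refl | apply: dco_refl_empty].
have wfs : wf_dirt Sig X (dcons op (foldr (@dcons Op) (Dirt fset0 t) s)).
  rewrite -[dcons _ _]/(foldr (@dcons Op) (Dirt fset0 t) (op :: s)) foldr_dcons.
  by split; first by apply/fsubsetP => x; rewrite !inE => xs; apply: sS; rewrite inE.
by apply: dco_op => //; apply: IH => x xs; apply: sS; rewrite inE xs orbT.
Qed.

Lemma vid_vco A K : has_vskel Sig X A K -> vco Sig X (vid A) A A.
Proof.
move: A K; apply: (@vty_mutind _ (fun A => forall K, _ -> vco Sig X (vid A) A A)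
  (fun C => forall K, has_cskel Sig X C K -> cco Sig X (cid C) C C)).
- by move=> a K HA; apply: vco_refl; exists K.
- by move=> K HA; apply: vco_refl_unit; exists K.
- move=> A IHA C IHC K H; inversion H; subst.
  by apply: vco_arr; [apply: IHA; eauto | apply: IHC; eauto | exists (SArr K1 K2)].
- move=> A IHA D K H; inversion H; subst.
  by apply: cco_bang; [apply: IHA; eauto | apply: did_dco | exists K].
Qed.

Lemma vco_wf g A B : vco Sig X g A B -> wf_vle Sig X A B.
Proof. by case. Qed.

Hypothesis wfX : wf_ctx Sig X.

(** Rests on each type parameter being declared only once; needed to compose coercions. *)
Lemma has_vskel_inj A K K' : has_vskel Sig X A K -> has_vskel Sig X A K' -> K = K'.
Proof.
move: A K K'; apply: (@vty_mutind _
  (fun A => forall K K', has_vskel Sig X A K -> has_vskel Sig X A K' -> K = K')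
  (fun C => forall K K', has_cskel Sig X C K -> has_cskel Sig X C K' -> K = K')).
- move=> a K K' H H'; inversion_clear H as [? ? aX _| |].
  inversion_clear H' as [? ? aX' _| |].
  by have [] := param_of_inj wfX aX aX' erefl.
- by move=> K K' H H'; inversion H; inversion H'.
- move=> A IHA C IHC K K' H H'; inversion H; inversion H'; subst.
  by congr SArr; [apply: IHA | apply: IHC].
- by move=> A IHA D K K' H H'; inversion H; inversion H'; subst; apply: IHA.
Qed.

(** The composition rule presupposes a common skeleton of the outer types; it exists because the
    middle type has only one skeleton. *)
Lemma vco_trans g1 g2 A1 A2 A3 :
  vco Sig X g1 A1 A2 -> vco Sig X g2 A2 A3 -> vco Sig X (VCComp g2 g1) A1 A3.
Proof.
move=> H1 H2; have [K [H11 H12]] := vco_wf H1; have [K' [H22 H23]] := vco_wf H2.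
apply: vco_comp H1 H2 _; exists K; split=> //.
by rewrite (has_vskel_inj H12 H22).
Qed.

End Coercions.

(** A choice principle obtained without axioms: the context is a finite list, and distinct names let
    the function be extended one declaration at a time. *)
Lemma choose_tcoer (Op : choiceType) (X : ctx Op)
    (P : tcparam -> vty Op -> vty Op -> vcoer Op -> Prop) :
  List.NoDup (List.map (@param_of Op) X) ->
  (forall w A A', List.In (DeclTC w A A') X -> exists g, P w A A' g) ->
  exists f, forall w A A', List.In (DeclTC w A A') X -> P w A A' (f w).
Proof.
elim: X => [|d X IH] /= ndX HP; first by exists (@VCVar Op).
inversion_clear ndX as [|? ? dX ndX'].
have [|f Hf] := IH ndX'; first by move=> w A A' wX; apply: HP; right.
case: d dX HP => [s|s|a K|w D D'|w A A'] /= dX HP;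
  try by exists f => w0 B B' [//|]; apply: Hf.
have [g Hg] : exists g, P w A A' g by apply: HP; left.
exists (fun v => if v == w then g else f v) => v B B' [[<- <- <-]|vX].
  by rewrite eqxx.
(* A later declaration named [w] would repeat a name. *)
case: eqP => [ev|_]; last exact: Hf.
by case: dX; rewrite -ev; apply: (List.in_map (@param_of Op)) vX.
Qed.

Section RenameInstantiation.

Variables (Op : choiceType) (Sig : {fset Op}) (Xuse X : ctx Op) (F : polarity).
Variables (eta : subst Op) (b b' : tparam) (g0 : vcoer Op).
Hypotheses (wfX : wf_ctx Sig X) (redX : reduced X) (FX : polarity_in X F).
Hypothesis eta_ok : valid_subst Sig X eta Xuse.
Hypothesis coer_ok : forall w a1 a2, List.In (DeclTC w (TVar _ a1) (TVar _ a2)) X ->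
  exists g, vco Sig Xuse g (sub_t eta (if a1 == b then b' else a1))
                           (sub_t eta (if a2 == b then b' else a2)).
Hypothesis pos_ok : b \in pset_t F.1 -> vco Sig Xuse g0 (sub_t eta b') (sub_t eta b).
Hypothesis neg_ok : b \in pset_t F.2 -> vco Sig Xuse g0 (sub_t eta b) (sub_t eta b').

(** The common core of (In) and (Out), which differ only in how [coer_ok] is met and in which
    polarity may contain [b]. *)
Lemma ren_instantiation : exists eta' Y,
  valid_subst Sig (ren_ctx b b' X) eta' Xuse /\
  fam_le Sig Xuse Y (comp_subst eta' (ren Op b b')) eta F.
Proof.
have app_ren a : app_vty eta (if a == b then TVar Op b' else TVar Op a)
    = sub_t eta (if a == b then b' else a) by case: ifP.
have [|f Hf] := @choose_tcoer _ X (fun _ A A' g => vco Sig Xuse g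
  (app_vty eta (app_vty (ren Op b b') A)) (app_vty eta (app_vty (ren Op b b') A')))
  (proj1 wfX).
  move=> w A A' wX; have [a1 [a2 [eA eA']]] := redX wX; subst A A'.
  by rewrite /= !app_ren; apply: coer_ok wX.
exists (Subst (sub_s eta) (sub_d eta) (sub_t eta) (sub_dc eta) f).
exists (Family (fun a => if a == b then g0 else vid (sub_t eta a))
               (fun d => did (sub_d eta d))).
split.
  move=> d' /In_pmap [d dX]; have := eta_ok dX; have := redX dX; move: dX.
  case: d => [s|s|a K|w D D'|w A A'] /= dX.
  - by move=> _ H [<-].
  - by move=> _ H [<-].
  (* Reducedness makes [K] a skeleton parameter, where both instantiations agree by computation. *)
  - by case=> s eK; subst K; case: ifP => // _ H [<-].
  - by move=> _ H [<-].
  - case=> a1 [a2 [eA eA']] _ [<-]; subst A A'; move: (Hf _ _ _ dX) => /=.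
    by case: (a1 == b); case: (a2 == b).
have [[tF1 dF1] [tF2 dF2]] := FX.
have app_dvar s d : app_dirt s (dvar Op d) = sub_d s d.
  by rewrite /app_dirt /= fset0U; case: (sub_d s d).
have dirt_ok d : List.In (DeclD _ d) X ->
    dco Sig Xuse (did (sub_d eta d)) (sub_d eta d) (sub_d eta d).
  by move=> dX; apply: did_dco; apply: (eta_ok dX).
have type_ok a K : List.In (DeclT _ a K) X ->
    vco Sig Xuse (vid (sub_t eta a)) (sub_t eta a) (sub_t eta a).
  by move=> /eta_ok; apply: vid_vco.
split=> [a aF|d dF|a aF|d dF] /=.
- case: (eqVneq a b) => [ea|_] /=; first by rewrite ea; apply: pos_ok; rewrite -ea.
  by have [K] := tF1 _ aF; apply: type_ok.
- by rewrite app_dvar; apply/dirt_ok/dF1.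
- case: (eqVneq a b) => [ea|_] /=; first by rewrite ea; apply: neg_ok; rewrite -ea.
  by have [K] := tF2 _ aF; apply: type_ok.
- by rewrite app_dvar; apply/dirt_ok/dF2.
Qed.

End RenameInstantiation.

Theorem proposition5p4 (Op : choiceType) (Sig : {fset Op}) (Xuse : ctx Op)
    (wf_use : wf_ctx Sig Xuse) :
  complete Xuse (bridge_in Sig) /\ complete Xuse (bridge_out Sig).
Proof.
split=> X F _ _ [wfX redX FX [w [a [a' [wX /eqP neq_a uniq_w nF [-> ->]]]]]] eta eta_ok;
  have w_ok := eta_ok _ wX; have [K [Ka Ka']] := vco_wf w_ok.
- apply: (@ren_instantiation _ _ _ _ _ _ _ _ (sub_tc eta w)) => //; last by rewrite (negbTE nF).
  move=> v a1 a2 vX; have v_ok := eta_ok _ vX.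
  (* Here [v] must be [w], and its renamed inequality is [a <= a]. *)
  case: (eqVneq a2 a') => [e2|n2].
    subst a2; have ev := uniq_w _ _ vX; subst v.
    have [->] := param_of_inj wfX vX wX erefl.
    by rewrite (negbTE neq_a); exists (vid (sub_t eta a)); apply: vid_vco Ka.
  (* An inequality [a' <= a2] becomes [a <= a2], reached through [a']. *)
  case: (eqVneq a1 a') => [e1|n1]; last by exists (sub_tc eta v).
  by subst a1; exists (VCComp (sub_tc eta v) (sub_tc eta w)); apply: vco_trans w_ok v_ok.
- apply: (@ren_instantiation _ _ _ _ _ _ _ _ (sub_tc eta w)) => //; first last.
    by rewrite (negbTE nF).
  move=> v a1 a2 vX; have v_ok := eta_ok _ vX.
  case: (eqVneq a1 a) => [e1|n1].
    subst a1; have ev := uniq_w _ _ vX; subst v.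
    have [->] := param_of_inj wfX vX wX erefl.
    by rewrite eq_sym (negbTE neq_a); exists (vid (sub_t eta a')); apply: vid_vco Ka'.
  (* Dually, [a1 <= a] becomes [a1 <= a'], so [w] is now applied last. *)
  case: (eqVneq a2 a) => [e2|n2]; last by exists (sub_tc eta v).
  by subst a2; exists (VCComp (sub_tc eta w) (sub_tc eta v)); apply: vco_trans v_ok w_ok.
Qed.
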